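(* Let $A$ be a commutative ring and let $e, e' \in A$ be idempotents. Then there is a canonical isomorphism of $A$-modules $$Ae\oplus Ae'\;\simeq\; Ae/Ae(1-e')\;\oplus\; Ae'/Ae'(1-e)\;\oplus\; A(e+e'-2ee').$$
   Context: All rings are commutative with identity. For $x\in A$, $Ax$ denotes the principal ideal generated by $x$, regarded as an $A$-module; $Ae(1-e')$ is the principal ideal generated by $e(1-e')$, a submodule of $Ae$, and $Ae'(1-e)$ is the principal ideal generated by $e'(1-e)$, a submodule of $Ae'$. *)

(* Defs.v *)
From HB Require Import structures.
From mathcomp Require Import all_boot all_algebra.
From mathcomp Require Import boolp.

Set Implicit Arguments.
Unset Strict Implicit.
Unset Printing Implicit Defensive.

Import GRing.Theory.
Local Open Scope ring_scope.
Local Open Scope quotient_scope.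

Section PrincipalIdeal.
Variable A : comPzRingType.

(* A ring A is a module over itself as A^o; the zero ring is allowed. *)
Definition principal_ideal (x : A) : {pred A^o} :=
  [pred y : A^o | `[< exists a : A, y = a * x >]].

Lemma principal_idealP (x y : A) :
  reflect (exists a : A, y = a * x) (y \in principal_ideal x).
Proof. exact: asboolP. Qed.

Lemma principal_ideal_submod (x : A) : submod_closed (principal_ideal x).
Proof.
split=> [|a u v /principal_idealP[b ->] /principal_idealP[c ->]].
  by apply/principal_idealP; exists 0; rewrite mul0r.
by apply/principal_idealP; exists (a * b + c); rewrite mulrDl -mulrA.
Qed.

HB.instance Definition _ (x : A) :=
  GRing.isSubmodClosed.Build A A^o (principal_ideal x)
    (principal_ideal_submod x).

Record principal (x : A) := Principal {
  principal_val : A^o;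
  principal_valP : principal_val \in principal_ideal x
}.

HB.instance Definition _ (x : A) := [isSub for @principal_val x].
HB.instance Definition _ (x : A) := [Choice of principal x by <:].
HB.instance Definition _ (x : A) :=
  [SubChoice_isSubLmodule of principal x by <:].

(* The submodule Ay of Ax, as a predicate on the type of elements of Ax.  It
   is defined for all x and y, as the elements of Ax that lie in Ay; when y is
   a multiple of x these are all the elements of Ay. *)
Definition principal_in (x y : A) : {pred principal x} :=
  [pred u : principal x | val u \in principal_ideal y].
Arguments principal_in : clear implicits.

Lemma principal_in_submod (x y : A) : submod_closed (principal_in x y).
Proof.
split=> [|a u v uy vy]; rewrite inE ?raddf0 ?rpred0 //.
by rewrite linearP; apply: (principal_ideal_submod y).2.
Qed.

HB.instance Definition _ (x y : A) :=
  GRing.isSubmodClosed.Build A (principal x) (principal_in x y)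
    (principal_in_submod x y).

Lemma principal_ideal_mulr (x z : A) :
  {subset principal_ideal (x * z) <= principal_ideal x}.
Proof.
move=> y /principal_idealP[a ->]; apply/principal_idealP.
by exists (a * z); rewrite -mulrA [z * x]mulrC.
Qed.

End PrincipalIdeal.

Arguments principal_in {A} x y.

(* A copy of S: submodClosed is stated over semirings, so does not provide the
   closure under opposite needed to form Quotient.quot. *)
Definition submodule_pred (A : pzRingType) (V : lmodType A)
  (S : submodClosed V) : {pred V} := S.

HB.instance Definition _ (A : pzRingType) (V : lmodType A)
    (S : submodClosed V) :=
  GRing.isZmodClosed.Build V (submodule_pred S)
    (GRing.submod_closedB (submodClosedP S)).

(* MathComp's quotient of a commutative group by a subgroup, with the module
   structure it has when the subgroup is a submodule. *)
Definition quotient_module (A : pzRingType) (V : lmodType A)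
  (S : submodClosed V) : Type := {ideal_quot (submodule_pred S)}.

Section QuotientModule.
Variables (A : pzRingType) (V : lmodType A) (S : submodClosed V).
Local Notation Q := (quotient_module S).

HB.instance Definition _ := GRing.Zmodule.on Q.
HB.instance Definition _ :=
  ZmodQuotient.copy Q {ideal_quot (submodule_pred S)}.

Definition quotient_scale (a : A) (q : Q) : Q := \pi_Q (a *: repr q).

Lemma pi_scale (a : A) (v : V) : \pi_Q (a *: v) = quotient_scale a (\pi_Q v).
Proof.
have vS : v - repr (\pi_Q v) \in submodule_pred S.
  by rewrite Quotient.idealrBE reprK.
by apply/eqP; rewrite -Quotient.idealrBE -scalerBr [_ \in _]rpredZ.
Qed.

Lemma quotient_scaleA a b (q : Q) :
  quotient_scale a (quotient_scale b q) = quotient_scale (a * b) q.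
Proof. by rewrite -[q]reprK -(pi_scale b) -!pi_scale scalerA. Qed.

Lemma quotient_scale1 : left_id 1 quotient_scale.
Proof. by move=> q; rewrite -[q]reprK -pi_scale scale1r. Qed.

Lemma quotient_scaleDr : right_distributive quotient_scale +%R.
Proof.
move=> a p q; rewrite -[p]reprK -[q]reprK.
by rewrite -raddfD -!pi_scale -raddfD scalerDr.
Qed.

Lemma quotient_scaleDl (q : Q) : {morph quotient_scale^~ q : a b / a + b}.
Proof. by move=> a b; rewrite -[q]reprK -!pi_scale -raddfD scalerDl. Qed.

HB.instance Definition _ := GRing.Zmodule_isLmodule.Build A Q
  quotient_scaleA quotient_scale1 quotient_scaleDr quotient_scaleDl.

Definition quotient_map (v : V) : Q := \pi_Q v.

Lemma quotient_map_linear : linear quotient_map.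
Proof. move=> a u v; rewrite /quotient_map raddfD; congr (_ + _); exact: pi_scale. Qed.

HB.instance Definition _ :=
  GRing.isLinear.Build A V Q *:%R quotient_map quotient_map_linear.

End QuotientModule.

(* Main.v *)
(* For x in Ae and y in Ae', set w = (1 - e') x + (1 - e) y.  Then
   x = e' x + e w and y = e y + e' w, while e' x depends only on the class of x
   modulo Ae(1 - e'), and e y only on the class of y modulo Ae'(1 - e).  So
   (x, y) is recovered from the two classes and w. *)

Require Import Defs.
From HB Require Import structures.
From mathcomp Require Import all_boot all_algebra.
From mathcomp Require Import ring.

Set Implicit Arguments.
Unset Strict Implicit.
Unset Printing Implicit Defensive.

Import GRing.Theory.
Local Open Scope ring_scope.

Lemma quotient_map_eq (A : pzRingType) (V : lmodType A) (S : submodClosed V)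
    (u v : V) :
  (quotient_map S u = quotient_map S v) <-> (u - v \in S).
Proof.
by split=> [uv|uvS]; [have /eqP := uv|apply/eqP]; rewrite -Quotient.idealrBE.
Qed.

Lemma quotient_map_repr (A : pzRingType) (V : lmodType A) (S : submodClosed V)
    (q : quotient_module S) : quotient_map S (repr q) = q.
Proof. exact: reprK. Qed.

Section PrincipalMap.
Variables (A : comPzRingType) (x y c : A).
Hypothesis cxy : c * x \in principal_ideal y.

Lemma principal_map_subproof (u : principal x) :
  c * val u \in principal_ideal y.
Proof.
have /principal_idealP[a ->] := valP u.
have /principal_idealP[d cxE] := cxy.
by apply/principal_idealP; exists (a * d); rewrite mulrCA cxE mulrA.
Qed.

(** Multiplication by [c] as a map from Ax to Ay; the condition [cxy] on the generator [x] extends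
    to all multiples of [x]. *)
Definition principal_map (u : principal x) : principal y :=
  Principal (principal_map_subproof u).

Lemma principal_map_linear : linear principal_map.
Proof.
move=> a u v; apply: val_inj.
rewrite [RHS]linearP -[LHS]/(c * val (a *: u + v)) linearP /=.
by rewrite mulrDr -[X in c * X + _]/(a * _) mulrCA.
Qed.

HB.instance Definition _ :=
  GRing.isLinear.Build A (principal x) (principal y) *:%R principal_map
    principal_map_linear.

End PrincipalMap.

Lemma principal_idempotent (A : comPzRingType) (e : A) (he : e * e = e)
    (u : principal e) : e * val u = val u.
Proof. by have /principal_idealP[a ->] := valP u; rewrite mulrCA he. Qed.

Lemma mul_principal_ideal (A : comPzRingType) (e s : A) :
  e * s \in principal_ideal e.
Proof. by apply/principal_idealP; exists s; rewrite mulrC. Qed.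

Section Complement.
Variables (A : comPzRingType) (e e' s : A).
Hypotheses (he' : e' * e' = e') (es : e * s = e * (1 - e')).

Local Notation pi := (quotient_map (principal_in e (e * (1 - e')))).

(** Only the relation [es] ties [s] to [e] and [e'] in this section, so every lemma here can be
    reused with [e] and [e'] exchanged. *)
Lemma compl_mul_principal_ideal : (1 - e') * e \in principal_ideal s.
Proof. by apply/principal_idealP; exists e; rewrite es mulrC. Qed.

(** Two representatives of a class differ by a multiple of [e * (1 - e')], which [e'] kills; so
    multiplication by [e'] descends to the quotient. *)
Lemma scale_repr_quotient_map (u : principal e) :
  e' *: repr (pi u) = e' *: u.
Proof.
apply/eqP; rewrite -subr_eq0 -scalerBr; apply/eqP/val_inj.
have /quotient_map_eq := quotient_map_repr (pi u).
rewrite inE => /principal_idealP[a ra].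
rewrite raddf0 -[LHS]/(e' * val (repr (pi u) - u)) ra.
by ring: he'.
Qed.

Lemma quotient_map_scale_repr q (w : principal s) :
  pi (e' *: repr q + principal_map (mul_principal_ideal e s) w) = q.
Proof.
rewrite -[RHS]quotient_map_repr; apply/quotient_map_eq; rewrite inE.
have /principal_idealP[b wE] := valP w.
have /principal_idealP[a rE] := valP (repr q).
(* With [a * e] the representative and [w] equal to [b * s], the relation [es] turns the difference
   into e'ae + be(1 - e') - ae = (b - a)e(1 - e'). *)
apply/principal_idealP; exists (b - a).
rewrite -[LHS]/(e' * val (repr q) + e * val w - val (repr q)) wE rE.
by rewrite [e * _]mulrCA es; ring.
Qed.

End Complement.

Section Decomposition.
Variables (A : comPzRingType) (e e' s : A).
Hypotheses (es : e * s = e * (1 - e')) (e's : e' * s = e' * (1 - e)).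

Local Notation M :=
  (quotient_module (principal_in e (e * (1 - e')))
   * quotient_module (principal_in e' (e' * (1 - e)))
   * principal s)%type.

Definition decomp (z : principal e * principal e') : M :=
  (quotient_map _ z.1, quotient_map _ z.2,
   principal_map (compl_mul_principal_ideal es) z.1
   + principal_map (compl_mul_principal_ideal e's) z.2).

Lemma decomp_linear : linear decomp.
Proof.
move=> a u v; rewrite /decomp !linearP /=; congr (_, _, _).
by rewrite addrACA -scalerDr.
Qed.

HB.instance Definition _ :=
  GRing.isLinear.Build A (principal e * principal e')%type M *:%R decomp
    decomp_linear.

(** The recovery formulas x = e'x + ew and y = ey + e'w, with e'x and ey computed from chosen
    representatives of the two classes. *)
Definition recomp (q : M) : principal e * principal e' :=
  (e' *: repr q.1.1 + principal_map (mul_principal_ideal e s) q.2,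
   e *: repr q.1.2 + principal_map (mul_principal_ideal e' s) q.2).

Hypotheses (he : e * e = e) (he' : e' * e' = e').

Lemma decompK : cancel decomp recomp.
Proof.
move=> [x y]; rewrite /recomp /decomp /= !scale_repr_quotient_map //.
have xe := principal_idempotent he x; have ye' := principal_idempotent he' y.
congr (_, _); apply: val_inj.
  rewrite -[LHS]/(e' * val x + e * ((1 - e') * val x + (1 - e) * val y)).
  (* Since e(1 - e) = 0, the [y] term drops out, leaving e'x + e(1 - e')x = ex = x. *)
  by ring: he xe.
rewrite -[LHS]/(e * val y + e' * ((1 - e') * val x + (1 - e) * val y)).
by ring: he' ye'.
Qed.

Lemma recompK (sE : s = e * (1 - e') + e' * (1 - e)) : cancel recomp decomp.
Proof.
move=> [[p q] w]; rewrite /recomp /decomp /=.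
congr (_, _, _); [exact: quotient_map_scale_repr..|apply: val_inj].
set r := repr p; set t := repr q.
rewrite -[LHS]/((1 - e') * (e' * val r + e * val w)
                + (1 - e) * (e * val t + e' * val w)).
(* [s] is a sum of the orthogonal idempotents [e * (1 - e')] and [e' * (1 - e)], hence idempotent,
   and so acts as the identity on As. *)
have ws : val w = (e * (1 - e') + e' * (1 - e)) * val w.
  have /principal_idealP[b ->] := valP w.
  by rewrite mulrCA; congr (_ * _); rewrite sE; ring: he he'.
by rewrite [RHS]ws; ring: he he'.
Qed.

End Decomposition.

(** The three equations determine [f] on every pair, which makes precise that the isomorphism is
    canonical. *)
Theorem theorem4p3 (A : comPzRingType) (e e' : A)
    (he : e * e = e) (he' : e' * e' = e') :
  exists f : {linear (principal e * principal e')%type ->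
      (quotient_module (principal_in e (e * (1 - e')))
       * quotient_module (principal_in e' (e' * (1 - e)))
       * principal (e + e' - 2%:R * e * e'))%type},
    bijective f /\
    forall (x : principal e) (y : principal e'),
      [/\ (f (x, y)).1.1 = quotient_map (principal_in e (e * (1 - e'))) x,
          (f (x, y)).1.2 = quotient_map (principal_in e' (e' * (1 - e))) y
        & principal_val (f (x, y)).2 =
            (1 - e') * principal_val x + (1 - e) * principal_val y].
Proof.
(* In the Boolean algebra of idempotents, [s] is the symmetric difference of [e] and [e']. *)
pose s := e + e' - 2%:R * e * e'.
have es : e * s = e * (1 - e') by rewrite /s; ring: he.
have e's : e' * s = e' * (1 - e) by rewrite /s; ring: he'.
exists (decomp es e's); split=> //.
exists (@recomp A e e' s); first exact: decompK.
by apply: recompK => //; rewrite /s; ring.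
Qed.
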